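(* Let $\mathbb{K}$ be a field, let $X$ be a finite-dimensional non-degenerate evolution $\mathbb{K}$-algebra, and let $X=\bigoplus_{j=1}^r X_j$ be its optimal direct-sum decomposition into indecomposable evolution ideals. Assume that each $X_j$ has balance $\operatorname{b}(X_j)>1$. Then $X$ gives rise to a zero-divisor in the Grothendieck ring $\mathcal{G}$ of finite-dimensional non-degenerate evolution $\mathbb{K}$-algebras, that is, there exist finite-dimensional non-degenerate evolution $\mathbb{K}$-algebras $A$ and $B$ such that $A\otimes X\cong B\otimes X$ while $A\not\cong B$.
   Context: An evolution algebra over a field $\mathbb{K}$ is a (finite-dimensional, not necessarily associative) $\mathbb{K}$-algebra $X$ admitting a natural basis, i.e. a basis $B=\{e_1,\dots,e_n\}$ with $e_ie_j=0$ for $i\ne j$. Writing $e_i^2=\sum_k w_{ik}e_k$, the matrix $(w_{ik})$ is the structure matrix. $X$ is non-degenerate if it has a natural basis with $e_i^2\neq 0$ for all $i$ (equivalently $\{x: xX=0\}=0$, so this is independent of the natural basis). An evolution ideal is an ideal which is itself an evolution algebra. A nonzero evolution algebra is indecomposable if it is not a direct sum of two nonzero evolution ideals. Every finite-dimensional non-degenerate evolution algebra is, in a unique way, a direct sum of indecomposable evolution ideals (its optimal direct-sum decomposition). Isomorphism $\cong$ means isomorphism of $\mathbb{K}$-algebras. The class of finite-dimensional non-degenerate evolution algebras is closed under direct sum $\oplus$ and tensor product $\otimes$ over $\mathbb{K}$. The Grothendieck ring $\mathcal{G}$ is the group completion of the commutative monoid of isomorphism classes $[X]$ of finite-dimensional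 non-degenerate evolution $\mathbb{K}$-algebras with $[X]+[Y]=[X\oplus Y]$, with multiplication $[X]\cdot[Y]=[X\otimes Y]$ and unit $[\mathbb{K}]$. Balance: the graph $\Gamma(X,B)$ of $X$ relative to a natural basis $B$ is the directed graph on $\{1,\dots,n\}$ with an edge $(i,k)$ whenever $w_{ik}\ne 0$. A path in a directed graph is a sequence $(v_0,e_1,v_1,\dots,e_n,v_n)$, $n\ge 0$, of vertices and edges where each $e_i$ is traversed either forwards ($e_i=(v_{i-1},v_i)$) or backwards ($e_i=(v_i,v_{i-1})$); its balance is the number of forward steps minus the number of backward steps (a loop may be traversed in either direction, contributing $+1$ or $-1$ accordingly). A cycle is a path with $v_0=v_n$ (not necessarily simple). The balance of a graph is the gcd of the absolute values of the balances of all its cycles. The balance $\operatorname{b}(X)$ of a nonzero non-degenerate evolution algebra is the balance of $\Gamma(X,B)$ for any natural basis $B$ (the value does not depend on $B$). *)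

(* Defs.v *)
From HB Require Import structures.
From mathcomp Require Import all_boot all_order all_algebra.

Set Implicit Arguments.
Unset Strict Implicit.
Unset Printing Implicit Defensive.

Import GRing.Theory.
Local Open Scope ring_scope.

Section Algebras.
Variable K : fieldType.

(* Finite-dimensional, not necessarily associative, commutative or unital. *)
Record nalg := NAlg {
  nalg_sort :> vectType K;
  nalg_mul : {bilinear nalg_sort -> nalg_sort -> nalg_sort} }.

Definition amul (A : nalg) (x y : A) : A := nalg_mul A x y.

Lemma amulDl (A : nalg) (x y z : A) : amul (x + y) z = amul x z + amul y z.
Proof. exact: linearDl. Qed.
Lemma amulDr (A : nalg) (x y z : A) : amul z (x + y) = amul z x + amul z y.
Proof. exact: linearDr. Qed.
Lemma amulZl (A : nalg) k (x y : A) : amul (k *: x) y = k *: amul x y.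
Proof. exact: linearZl_LR. Qed.
Lemma amulZr (A : nalg) k (x y : A) : amul x (k *: y) = k *: amul x y.
Proof. exact: linearZr_LR. Qed.
Lemma amul0l (A : nalg) (x : A) : amul 0 x = 0.
Proof. exact: linear0l. Qed.
Lemma amul0r (A : nalg) (x : A) : amul x 0 = 0.
Proof. exact: linear0r. Qed.

Lemma amul_suml (A : nalg) n (a : 'I_n -> A) c :
  amul (\sum_i a i) c = \sum_i amul (a i) c.
Proof.
by elim/big_rec2: _ => [|i y x _ <-]; rewrite ?amul0l ?amulDl.
Qed.
Lemma amul_sumr (A : nalg) n (a : 'I_n -> A) c :
  amul c (\sum_i a i) = \sum_i amul c (a i).
Proof.
by elim/big_rec2: _ => [|i y x _ <-]; rewrite ?amul0r ?amulDr.
Qed.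

Definition alg_iso (A B : nalg) : Prop :=
  exists f : {linear A -> B},
    bijective f /\ {morph f : x y / amul x y >-> amul x y}.

Definition natural_basis (A : nalg) (n : nat) (e : n.-tuple A) : Prop :=
  basis_of fullv e /\ (forall i j : 'I_n, i != j -> amul e`_i e`_j = 0).

Definition evolution (A : nalg) : Prop :=
  exists n (e : n.-tuple A), natural_basis e.

Definition nondegenerate (A : nalg) : Prop :=
  exists n (e : n.-tuple A),
    natural_basis e /\ (forall i : 'I_n, amul e`_i e`_i != 0).

Definition ideal (A : nalg) (U : {vspace A}) : Prop :=
  forall u x : A, u \in U -> amul u x \in U /\ amul x u \in U.

(* The projection makes the product total, so that no closure proof is carried;
   on a subspace closed under multiplication it does nothing (sub_mulE). *)
Definition sub_mul (A : nalg) (U : {vspace A}) (x y : subvs_of U) :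
  subvs_of U := vsproj U (amul (vsval x) (vsval y)).

Fact sub_mul_bilinear (A : nalg) (U : {vspace A}) :
  bilinear_for *:%R *:%R (@sub_mul A U).
Proof.
by split=> u k x y; rewrite /sub_mul [vsval (_ + _)]linearP
  ?amulDr ?amulDl ?amulZr ?amulZl linearP.
Qed.
HB.instance Definition _ (A : nalg) (U : {vspace A}) :=
  bilinear_isBilinear.Build K (subvs_of U) (subvs_of U) (subvs_of U)
    _ _ (@sub_mul A U) (sub_mul_bilinear U).

Definition sub_alg (A : nalg) (U : {vspace A}) : nalg :=
  @NAlg (subvs_of U) (@sub_mul A U).

Lemma sub_mulE (A : nalg) (U : {vspace A}) (x y : sub_alg U) :
  ideal U -> vsval (amul x y) = amul (vsval x) (vsval y).
Proof. by move=> idU; rewrite vsprojK //; case: (idU _ (vsval y) (subvsP x)). Qed.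

Definition evolution_ideal (A : nalg) (U : {vspace A}) : Prop :=
  ideal U /\ evolution (sub_alg U).

Definition indecomposable (A : nalg) : Prop :=
  (fullv : {vspace A}) != 0%VS /\
  ~ (exists U V : {vspace A},
       [/\ evolution_ideal U, evolution_ideal V, U != 0%VS, V != 0%VS &
           (U + V = fullv)%VS /\ directv (U + V)]).

Definition optimal_decomposition (A : nalg) (r : nat)
    (U : 'I_r -> {vspace A}) : Prop :=
  [/\ forall j, evolution_ideal (U j) /\ indecomposable (sub_alg (U j)),
      directv (\sum_(j < r) U j) & (\sum_(j < r) U j = fullv)%VS].

Definition structure_matrix (A : nalg) (n : nat) (e : n.-tuple A) : 'M[K]_n :=
  \matrix_(i, k) coord e k (amul e`_i e`_i).

Definition evolution_graph (A : nalg) (n : nat) (e : n.-tuple A) : rel 'I_n :=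
  fun i k => structure_matrix e i k != 0.

(* A path is given by its first vertex and the list of its steps: a step
   (true, w) traverses an edge forwards to w, a step (false, w) traverses
   backwards, to w, an edge starting at w. *)
Fixpoint is_gpath (V : Type) (g : rel V) (v : V) (p : seq (bool * V)) : bool :=
  if p is (fwd, w) :: p' then (if fwd then g v w else g w v) && is_gpath g w p'
  else true.

Definition gpath_balance (V : Type) (p : seq (bool * V)) : int :=
  \sum_(s <- p) (if s.1 then 1 else -1).

Definition is_gcycle (V : Type) (g : rel V) (v : V) (p : seq (bool * V)) : Prop :=
  is_gpath g v p /\ last v (map snd p) = v.

Definition is_gcd (S : nat -> Prop) (d : nat) : Prop :=
  (forall s, S s -> (d %| s)%N) /\
  (forall m, (forall s, S s -> (m %| s)%N) -> (m %| d)%N).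

Definition graph_has_balance (V : Type) (g : rel V) (d : nat) : Prop :=
  is_gcd (fun s => exists v p, is_gcycle g v p /\ s = `|gpath_balance p|%N) d.

Definition has_balance (A : nalg) (d : nat) : Prop :=
  exists n (e : n.-tuple A),
    natural_basis e /\ graph_has_balance (evolution_graph e) d.

Definition zero_mul (x y : 'rV[K]_0) : 'rV[K]_0 := 0.

Fact zero_mul_bilinear : bilinear_for *:%R *:%R zero_mul.
Proof. by split=> u k x y; apply/rowP => -[]. Qed.
HB.instance Definition _ := bilinear_isBilinear.Build K
  'rV[K]_0 'rV[K]_0 'rV[K]_0 _ _ zero_mul zero_mul_bilinear.

Definition zero_alg : nalg := @NAlg 'rV[K]_0 zero_mul.

Definition dsum_mul (A B : nalg) (x y : A * B) : A * B :=
  (amul x.1 y.1, amul x.2 y.2).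

Fact dsum_mul_bilinear (A B : nalg) :
  bilinear_for *:%R *:%R (@dsum_mul A B).
Proof.
by split=> u k x y; apply/eqP; rewrite /dsum_mul xpair_eqE /=
  ?amulDl ?amulDr ?amulZl ?amulZr !eqxx.
Qed.
HB.instance Definition _ (A B : nalg) := bilinear_isBilinear.Build K
  (A * B)%type (A * B)%type (A * B)%type _ _ (@dsum_mul A B)
  (@dsum_mul_bilinear A B).

Definition dsum_alg (A B : nalg) : nalg := @NAlg (A * B)%type (@dsum_mul A B).

(* The tensor product of A and B, by coordinates: the (i, j) entry of a matrix is
   the coefficient of a_i (x) b_j, for (a_i) and (b_j) the canonical bases vbasis
   of the underlying vector spaces; pure_tensor a b is a (x) b. *)
Section Tensor.
Variables A B : nalg.

Local Notation tens_sort := 'M[K]_(\dim {:A}, \dim {:B}).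

Definition pure_tensor (a : A) (b : B) : tens_sort :=
  \matrix_(i, j) (coord (vbasis {:A}) i a * coord (vbasis {:B}) j b).

Definition tens_mul (M N : tens_sort) : tens_sort :=
  \sum_i \sum_j \sum_k \sum_l (M i j * N k l) *:
    pure_tensor (amul (vbasis {:A})`_i (vbasis {:A})`_k)
                (amul (vbasis {:B})`_j (vbasis {:B})`_l).

Lemma tens_mul_linl c (M N P : tens_sort) :
  tens_mul (c *: M + N) P = c *: tens_mul M P + tens_mul N P.
Proof.
rewrite /tens_mul; do 4!
  (rewrite scaler_sumr -big_split; apply: eq_bigr => ? _ /=).
by rewrite !mxE mulrDl scalerDl scalerA mulrA.
Qed.
Lemma tens_mul_linr c (M N P : tens_sort) :
  tens_mul P (c *: M + N) = c *: tens_mul P M + tens_mul P N.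
Proof.
rewrite /tens_mul; do 4!
  (rewrite scaler_sumr -big_split; apply: eq_bigr => ? _ /=).
by rewrite !mxE mulrDr scalerDl scalerA mulrCA.
Qed.
Fact tens_mul_bilinear : bilinear_for *:%R *:%R tens_mul.
Proof. by split=> P c M N; [exact: tens_mul_linl | exact: tens_mul_linr]. Qed.
HB.instance Definition _ := bilinear_isBilinear.Build K
  tens_sort tens_sort tens_sort _ _ tens_mul tens_mul_bilinear.

Definition tens_alg : nalg := @NAlg tens_sort tens_mul.

Lemma pure_tensorZl k a b : pure_tensor (k *: a) b = k *: pure_tensor a b.
Proof. by apply/matrixP=> i j; rewrite !mxE linearZ /= mulrA. Qed.
Lemma pure_tensorZr k a b : pure_tensor a (k *: b) = k *: pure_tensor a b.
Proof. by apply/matrixP=> i j; rewrite !mxE linearZ /= mulrCA. Qed.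
Lemma pure_tensor_suml n (a : 'I_n -> A) b :
  pure_tensor (\sum_i a i) b = \sum_i pure_tensor (a i) b.
Proof.
apply/matrixP=> i j; rewrite summxE !mxE linear_sum /= mulr_suml.
by apply: eq_bigr => k _; rewrite mxE.
Qed.
Lemma pure_tensor_sumr n a (b : 'I_n -> B) :
  pure_tensor a (\sum_i b i) = \sum_i pure_tensor a (b i).
Proof.
apply/matrixP=> i j; rewrite summxE !mxE linear_sum /= mulr_sumr.
by apply: eq_bigr => k _; rewrite mxE.
Qed.

Lemma tens_mulE (a a' : A) (b b' : B) :
  amul (pure_tensor a b : tens_alg) (pure_tensor a' b')
  = pure_tensor (amul a a') (amul b b').
Proof.
rewrite [in RHS](coord_vbasis (memvf a)) [in RHS](coord_vbasis (memvf a')).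
rewrite [in RHS](coord_vbasis (memvf b)) [in RHS](coord_vbasis (memvf b')).
rewrite amul_suml pure_tensor_suml; apply: eq_bigr => i _.
rewrite amul_suml pure_tensor_sumr; apply: eq_bigr => j _.
rewrite amul_sumr pure_tensor_suml; apply: eq_bigr => k _.
rewrite amul_sumr pure_tensor_sumr; apply: eq_bigr => l _.
rewrite !(amulZl, amulZr, pure_tensorZl, pure_tensorZr) !scalerA !mxE.
by congr (_ *: _); rewrite mulrA; congr (_ * _); exact: mulrAC.
Qed.

End Tensor.

Lemma nondegenerate_family (A : nalg) (I : finType) (F : I -> A) :
  (forall x, exists c : I -> K, x = \sum_i c i *: F i) ->
  (#|I| <= \dim {:A})%N ->
  (forall i j, i != j -> amul (F i) (F j) = 0) ->
  (forall i, amul (F i) (F i) != 0) -> nondegenerate A.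
Proof.
move=> spanF dimF orthF sqF.
pose e := [tuple F (enum_val k) | k < #|I|].
have eE (k : 'I_#|I|) : e`_k = F (enum_val k) by rewrite -tnth_nth tnth_mktuple.
exists #|I|, e; split; last by move=> i; rewrite eE.
split=> [|i j ne_ij]; last by rewrite !eE orthF // (inj_eq enum_val_inj).
rewrite basisEdim size_tuple dimF andbT; apply/subvP=> x _.
have [c ->] := spanF x; apply: memv_suml => i _; apply/memvZ/memv_span.
by apply/tnthP; exists (enum_rank i); rewrite tnth_mktuple enum_rankK.
Qed.

Lemma natural_basis_coord (A : nalg) n (e : n.-tuple A) x :
  natural_basis e -> x = \sum_i coord e i x *: e`_i.
Proof. by case=> be _; apply: coord_basis be _; rewrite memvf. Qed.

Lemma natural_basis_dim (A : nalg) n (e : n.-tuple A) :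
  natural_basis e -> \dim {:A} = n.
Proof. by case=> /size_basis. Qed.

Lemma zero_nondegenerate : nondegenerate zero_alg.
Proof.
apply: (@nondegenerate_family zero_alg 'I_0 (fun _ => 0)) => [x||[]|[]] //.
  by exists (fun _ => 0); apply/rowP=> -[].
by rewrite card_ord.
Qed.

Lemma fst_sum (A B : nalg) n (G : 'I_n -> A * B) :
  (\sum_i G i).1 = \sum_i (G i).1.
Proof. by elim/big_rec2: _ => [|i y x _ <-]. Qed.
Lemma snd_sum (A B : nalg) n (G : 'I_n -> A * B) :
  (\sum_i G i).2 = \sum_i (G i).2.
Proof. by elim/big_rec2: _ => [|i y x _ <-]. Qed.

Lemma dsum_nondegenerate (A B : nalg) :
  nondegenerate A -> nondegenerate B -> nondegenerate (dsum_alg A B).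
Proof.
move=> [m [e [be se]]] [n [f [bf sf]]].
pose F (i : 'I_m + 'I_n) : dsum_alg A B :=
  match i with inl i => (e`_i, 0) | inr j => (0, f`_j) end.
apply: (@nondegenerate_family (dsum_alg A B) _ F).
- move=> [x y].
  exists (fun i => match i with inl i => coord e i x | inr j => coord f j y end).
  rewrite big_sumType /=; apply: injective_projections => /=.
    rewrite !fst_sum [X in _ + X]big1 ?addr0; last by move=> j _; exact: scaler0.
    exact: natural_basis_coord be.
  rewrite !snd_sum [X in X + _]big1 ?add0r; last by move=> i _; exact: scaler0.
  exact: natural_basis_coord bf.
- rewrite card_sum !card_ord dimvf -(natural_basis_dim be) -(natural_basis_dim bf).
  by rewrite !dimvf.
- move=> [i|i] [j|j] ne; apply: injective_projections; rewrite /= ?amul0l ?amul0r //.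
    exact: be.2.
  exact: bf.2.
move=> [i|j]; apply/eqP=> /= eq0.
  by move: (congr1 fst eq0) (se i) => /= ->; rewrite eqxx.
by move: (congr1 snd eq0) (sf j) => /= ->; rewrite eqxx.
Qed.


Lemma tens_vbasis (A B : nalg) (M : 'M[K]_(\dim {:A}, \dim {:B})) :
  M = \sum_i \sum_j M i j *: pure_tensor (vbasis {:A})`_i (vbasis {:B})`_j.
Proof.
have freeV (C : nalg) (i j : 'I_(\dim {:C})) :
    coord (vbasis {:C}) i (vbasis {:C})`_j = (j == i)%:R.
  by rewrite coord_free ?(basis_free (vbasisP _)).
apply/matrixP=> i j; rewrite summxE (bigD1 i) //= summxE (bigD1 j) //=.
rewrite !mxE !freeV !eqxx !mulr1 big1 => [|l ne]; last first.
  by rewrite !mxE !freeV (negPf ne) !mulr0.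
rewrite addr0 big1 ?addr0 // => k ne.
rewrite summxE big1 // => l _; rewrite !mxE !freeV (negPf ne).
by rewrite mul0r mulr0.
Qed.

Lemma pure_tensor_eq0 (A B : nalg) (a : A) (b : B) :
  a != 0 -> b != 0 -> pure_tensor a b != 0.
Proof.
move=> a0 b0.
have [i ai] : exists i, coord (vbasis {:A}) i a != 0.
  apply/existsP; apply: contraR a0; rewrite negb_exists => /forallP a0.
  rewrite (coord_vbasis (memvf a)) big1 // => i _.
  by move: (a0 i); rewrite negbK => /eqP ->; rewrite scale0r.
have [j bj] : exists j, coord (vbasis {:B}) j b != 0.
  apply/existsP; apply: contraR b0; rewrite negb_exists => /forallP b0.
  rewrite (coord_vbasis (memvf b)) big1 // => j _.
  by move: (b0 j); rewrite negbK => /eqP ->; rewrite scale0r.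
by apply/eqP=> /matrixP/(_ i j)/eqP; rewrite !mxE mulf_eq0 (negPf ai) (negPf bj).
Qed.

Lemma tens_span (A B : nalg) m n (e : m.-tuple A) (f : n.-tuple B)
    (M : 'M[K]_(\dim {:A}, \dim {:B})) :
  natural_basis e -> natural_basis f ->
  M = \sum_(p : 'I_m * 'I_n) (\sum_i \sum_j M i j *
        (coord e p.1 (vbasis {:A})`_i * coord f p.2 (vbasis {:B})`_j)) *:
      pure_tensor e`_p.1 f`_p.2.
Proof.
move=> be bf; under eq_bigr => p _ do rewrite scaler_suml.
rewrite exchange_big {1}[M]tens_vbasis; apply: eq_bigr => i _ /=.
under [RHS]eq_bigr => p _ do rewrite scaler_suml.
rewrite exchange_big; apply: eq_bigr => j _ /=.
rewrite [X in pure_tensor X _](natural_basis_coord _ be) pure_tensor_suml.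
rewrite scaler_sumr -(pair_bigA _ (fun k l => (M i j * (coord e k (vbasis {:A})`_i *
  coord f l (vbasis {:B})`_j)) *: pure_tensor e`_k f`_l)) /=.
apply: eq_bigr => k _.
rewrite [X in pure_tensor _ X](natural_basis_coord _ bf) pure_tensor_sumr.
rewrite scaler_sumr; apply: eq_bigr => l _.
by rewrite pure_tensorZl pure_tensorZr !scalerA mulrA.
Qed.

Lemma tens_nondegenerate (A B : nalg) :
  nondegenerate A -> nondegenerate B -> nondegenerate (tens_alg A B).
Proof.
move=> [m [e [be se]]] [n [f [bf sf]]].
pose F (i : 'I_m * 'I_n) : tens_alg A B := pure_tensor e`_i.1 f`_i.2.
apply: (@nondegenerate_family (tens_alg A B) _ F).
- by move=> M; eexists; exact: tens_span be bf.
- by rewrite card_prod !card_ord dimvf /= dim_matrix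
    (natural_basis_dim be) (natural_basis_dim bf).
- move=> [i j] [k l]; rewrite xpair_eqE negb_and tens_mulE /= => /orP[ne|ne].
    by rewrite (be.2 _ _ ne) -(scale0r (0 : A)) pure_tensorZl scale0r.
  by rewrite (bf.2 _ _ ne) -(scale0r (0 : B)) pure_tensorZr scale0r.
by move=> [i j]; rewrite tens_mulE pure_tensor_eq0.
Qed.

Record ndalg := NdAlg {
  ndalg_alg :> nalg;
  ndalg_nondegenerate : nondegenerate ndalg_alg }.

Definition nd0 : ndalg := NdAlg zero_nondegenerate.
Definition ndsum (X Y : ndalg) : ndalg :=
  NdAlg (dsum_nondegenerate (ndalg_nondegenerate X) (ndalg_nondegenerate Y)).
Definition ndtens (X Y : ndalg) : ndalg :=
  NdAlg (tens_nondegenerate (ndalg_nondegenerate X) (ndalg_nondegenerate Y)).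

(* The Grothendieck ring as a setoid: the pair (A, B) is the formal difference
   [A] - [B], and equality in the group completion is groth_eq. *)
Definition groth := (ndalg * ndalg)%type.

Definition groth_eq (x y : groth) : Prop :=
  exists Z : ndalg,
    alg_iso (ndsum (ndsum x.1 y.2) Z) (ndsum (ndsum y.1 x.2) Z).

Definition groth_class (X : ndalg) : groth := (X, nd0).
Definition groth0 : groth := (nd0, nd0).

Definition groth_mul (x y : groth) : groth :=
  (ndsum (ndtens x.1 y.1) (ndtens x.2 y.2),
   ndsum (ndtens x.1 y.2) (ndtens x.2 y.1)).

(* z witnesses that x is a zero-divisor. *)
Definition zero_divisor_witness (x z : groth) : Prop :=
  ~ groth_eq z groth0 /\ groth_eq (groth_mul z x) groth0.

End Algebras.

(* Main.v *)
(* Let V be a finite abelian group with elements c_j, one for each block X_j,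
   such that c_j is killed by b(X_j) and no nonempty subset of the c_j sums to 0.
   The permutation (S, v) |-> (S, v + sum_(j in S) c_j) preserves the parity of
   S; A and B are the evolution algebras e_p^2 = e_(shift p) over the pairs with
   #|S| even, resp. odd.  Since all cycles of X_j have balance divisible by b(X_j),
   its vertices x carry a potential h(x) in V which increases by c_j along
   each edge.  Toggling j in S, and adding h(x) to v when j enters S and
   subtracting it when j leaves S, turns a pair ((S, v), x) of A (x) X into one
   of B (x) X and commutes with the edges; hence A (x) X ~ B (x) X.

   The number of nonzero homomorphisms to K is finite and additive for direct
   sums, hence an invariant of the class in the Grothendieck group.  For A and B
   it counts the fixed points of the permutation, which all have S empty: A has
   some and B has none. *)

Require Import Defs.
From HB Require Import structures.
From mathcomp Require Import all_boot all_order all_algebra ring.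

Set Implicit Arguments.
Unset Strict Implicit.
Unset Printing Implicit Defensive.

Import GRing.Theory.
Local Open Scope ring_scope.

(** * Structure tables indexed by finite types *)

Section Tables.
Variable K : fieldType.
Implicit Types A B : nalg K.

Definition family_tuple A (I : finType) (F : I -> A) :=
  [tuple F (enum_val k) | k < #|I|].

Definition fcoord A (I : finType) (F : I -> A) (i : I) (x : A) : K :=
  coord (family_tuple F) (enum_rank i) x.

(** Allowing any finite index type lets sums, products and tagged unions of index types label the
    bases of direct sums, tensor products and block decompositions without renumbering. *)
Definition has_table A (I : finType) (F : I -> A) (w : I -> I -> K) : Prop :=
  basis_of fullv (family_tuple F) /\
  forall i j, amul (F i) (F j) = if i == j then \sum_k w i k *: F k else 0.

Section Coordinates.
Variables (A : nalg K) (I : finType) (F : I -> A) (w : I -> I -> K).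

Lemma family_tupleE (k : 'I_#|I|) : (family_tuple F)`_k = F (enum_val k).
Proof. by rewrite -tnth_nth tnth_mktuple. Qed.

Lemma spanning_has_table :
  (forall x, exists c : I -> K, x = \sum_i c i *: F i) ->
  (#|I| <= \dim {:A})%N ->
  (forall i j, amul (F i) (F j) = if i == j then \sum_k w i k *: F k else 0) ->
  has_table F w.
Proof.
move=> spanF dimF mulF; split=> //.
rewrite basisEdim size_tuple dimF andbT; apply/subvP=> x _.
have [c ->] := spanF x; apply: memv_suml => i _; apply/memvZ/memv_span.
by apply/tnthP; exists (enum_rank i); rewrite tnth_mktuple enum_rankK.
Qed.

Fact fcoord_is_linear i : linear_for *%R (fcoord F i).
Proof. by move=> k x y; rewrite /fcoord linearP. Qed.
HB.instance Definition _ i := GRing.isLinear.Build K A K _ (fcoord F i)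
  (fcoord_is_linear i).

Hypothesis tabF : has_table F w.

Lemma has_table_dim : \dim {:A} = #|I|.
Proof. by case: tabF => /size_basis. Qed.

Lemma fcoord_sum x : x = \sum_i fcoord F i x *: F i.
Proof.
case: tabF => basF _; rewrite {1}(coord_basis basF (memvf x)).
rewrite (reindex (@enum_rank I)) /=; last exact: onW_bij (enum_rank_bij I).
by apply: eq_bigr => i _; rewrite family_tupleE enum_rankK.
Qed.

Lemma fcoordE i j : fcoord F i (F j) = (j == i)%:R.
Proof.
case: tabF => basF _; rewrite -[F j in LHS](congr1 F (enum_rankK j)).
rewrite -family_tupleE /fcoord coord_free ?(basis_free basF) //.
by rewrite (inj_eq enum_rank_inj).
Qed.

Lemma fcoord_comb i (c : I -> K) : fcoord F i (\sum_j c j *: F j) = c i.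
Proof.
rewrite linear_sum (bigD1 i) //= linearZ /= fcoordE eqxx mulr1 big1 ?addr0 // => j ne.
by rewrite linearZ /= fcoordE (negPf ne) mulr0.
Qed.

Lemma fcoord_inj x y : (forall i, fcoord F i x = fcoord F i y) -> x = y.
Proof.
by move=> eqc; rewrite (fcoord_sum x) (fcoord_sum y); apply: eq_bigr => i _; rewrite eqc.
Qed.

Lemma amul_sumE (J : finType) (G : J -> A) y :
  amul (\sum_j G j) y = \sum_j amul (G j) y /\
  amul y (\sum_j G j) = \sum_j amul y (G j).
Proof.
split; [apply: (big_morph (fun x => amul x y)) | apply: (big_morph (amul y))].
- by move=> u v; rewrite amulDl.
- exact: amul0l.
- by move=> u v; rewrite amulDr.
exact: amul0r.
Qed.

Lemma amul_fcoord x y :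
  amul x y = \sum_i (fcoord F i x * fcoord F i y) *: \sum_k w i k *: F k.
Proof.
rewrite [in LHS](fcoord_sum x) (amul_sumE _ _).1; apply: eq_bigr => i _.
rewrite [in LHS](fcoord_sum y) (amul_sumE _ _).2 (bigD1 i) //= big1 => [|j ne].
  by rewrite addr0 amulZl amulZr tabF.2 eqxx scalerA.
by rewrite amulZl amulZr tabF.2 eq_sym (negPf ne) !scaler0.
Qed.

Lemma fcoord_amul k x y :
  fcoord F k (amul x y) = \sum_i fcoord F i x * fcoord F i y * w i k.
Proof.
rewrite amul_fcoord linear_sum; apply: eq_bigr => i _.
by rewrite linearZ /= fcoord_comb.
Qed.

End Coordinates.

Lemma has_table_iso A B (I : finType) (F : I -> A) (G : I -> B) w :
  has_table F w -> has_table G w -> alg_iso A B.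
Proof.
move=> tabF tabG.
pose f x := \sum_i fcoord F i x *: G i.
have f_lin : linear f.
  move=> k x y; rewrite /f scaler_sumr -big_split; apply: eq_bigr => i _ /=.
  by rewrite linearP scalerDl scalerA.
pose f' : {linear A -> B} :=
  HB.pack f (GRing.isLinear.Build K A B _ f f_lin).
exists f'; split.
  exists (fun y => \sum_i fcoord G i y *: F i) => x.
    by apply: (fcoord_inj tabF) => i; rewrite (fcoord_comb tabF) (fcoord_comb tabG).
  by apply: (fcoord_inj tabG) => i; rewrite /= /f (fcoord_comb tabG) (fcoord_comb tabF).
move=> x y; apply: (fcoord_inj tabG) => k /=.
rewrite (fcoord_comb tabG) (fcoord_amul tabF) (fcoord_amul tabG).
by apply: eq_bigr => i _; rewrite !(fcoord_comb tabG).
Qed.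

Lemma has_table_reindex A (I J : finType) (F : I -> A) w (w' : J -> J -> K)
    (f : J -> I) :
  bijective f -> (forall i j, w (f i) (f j) = w' i j) ->
  has_table F w -> has_table (F \o f) w'.
Proof.
move=> bij_f eqw tabF; apply: spanning_has_table => [x||i j].
- exists (fun j => fcoord F (f j) x); rewrite {1}(fcoord_sum tabF x).
  by rewrite (reindex f) //; exact: onW_bij.
- by rewrite (has_table_dim tabF) (bij_eq_card bij_f).
rewrite /= tabF.2 (bij_eq bij_f); case: ifP => // _.
by rewrite (reindex f) /=; [apply: eq_bigr => k _; rewrite eqw | exact: onW_bij].
Qed.

(** The basis is pulled back along the inverse isomorphism. Invariance under isomorphism thus
    reduces to comparing two tables of one and the same algebra. *)
Lemma has_table_transfer A B (J : finType) (G : J -> B) w :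
  alg_iso A B -> has_table G w -> exists F : J -> A, has_table F w.
Proof.
move=> [f [[g fK gK] morf]] tabG; exists (g \o G).
have f_inj := can_inj fK.
have gD x y : g (x + y) = g x + g y by apply: f_inj; rewrite linearD !gK.
have gZ k x : g (k *: x) = k *: g x by apply: f_inj; rewrite linearZ /= !gK.
have g0 : g 0 = 0 by apply: f_inj; rewrite linear0 gK.
have gsum (c : J -> K) : g (\sum_j c j *: G j) = \sum_j c j *: g (G j).
  by rewrite (big_morph g gD g0); apply: eq_bigr => j _; rewrite gZ.
apply: spanning_has_table => [x||i j].
- by exists (fun j => fcoord G j (f x)); rewrite /= -gsum -(fcoord_sum tabG) fK.
- rewrite -(has_table_dim tabG).
  (* The bound on [#|J|]: the injective linear map [f] carries the whole space of [A] onto that of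
     [B]. *)
  pose h := linfun f.
  have <- : (h @: fullv)%VS = fullv.
    apply/vspaceP=> y; rewrite memvf; apply/memv_imgP.
    by exists (g y); rewrite ?memvf // lfunE /= gK.
  rewrite limg_dim_eq //; apply/eqP; rewrite capfv; apply/lker0P => x y.
  by rewrite !lfunE => /f_inj.
apply: f_inj; rewrite morf /= !gK tabG.2; case: ifP => _; last by rewrite linear0.
by rewrite -gsum gK.
Qed.

(** * Tables of direct sums and tensor products *)

Definition sum_table (I J : finType) (w : I -> I -> K) (w' : J -> J -> K)
    (p q : I + J) : K :=
  match p, q with
  | inl i, inl k => w i k
  | inr j, inr l => w' j l
  | _, _ => 0
  end.

Definition tens_table (I J : finType) (w : I -> I -> K) (w' : J -> J -> K)
    (p q : I * J) : K := w p.1 q.1 * w' p.2 q.2.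

Lemma has_table_zero : has_table (fun v : void => match v with end : zero_alg K)
  (fun v : void => match v with end).
Proof.
apply: spanning_has_table => [x||[]]; last by rewrite card_void.
by exists (fun=> 0); apply/rowP => -[].
Qed.

Lemma has_table_sum A B (I J : finType) (F : I -> A) (G : J -> B) w w' :
  has_table F w -> has_table G w' ->
  has_table (fun p : I + J => match p with inl i => (F i, 0) | inr j => (0, G j) end
    : dsum_alg A B) (sum_table w w').
Proof.
move=> tabF tabG.
have pair_sum (T : finType) (H : T -> A * B) : \sum_t H t = (\sum_t (H t).1, \sum_t (H t).2).
  by elim/big_rec3: _ => // t x y z _ ->; apply: injective_projections.
have sumE (c : I + J -> K) :
    \sum_p c p *: (match p with inl i => (F i, 0) | inr j => (0, G j) end
      : dsum_alg A B) = (\sum_i c (inl i) *: F i, \sum_j c (inr j) *: G j).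
  rewrite big_sumType /= !pair_sum; apply: injective_projections => /=.
    by rewrite [X in _ + X]big1 ?addr0 // => j _; rewrite scaler0.
  by rewrite [X in X + _]big1 ?add0r // => j _; rewrite scaler0.
apply: spanning_has_table => [[x y]||p q].
- exists (fun p => match p with inl i => fcoord F i x | inr j => fcoord G j y end).
  by rewrite sumE -(fcoord_sum tabF) -(fcoord_sum tabG).
- by rewrite card_sum -(has_table_dim tabF) -(has_table_dim tabG) !dimvf.
have zeroE (T : finType) (C : nalg K) (H : T -> C) : \sum_t 0 *: H t = 0.
  by apply: big1 => t _; rewrite scale0r.
have eq_inl (i k : I) : (inl i == inl k :> I + J) = (i == k) by [].
have eq_inr (j l : J) : (inr j == inr l :> I + J) = (j == l) by [].
rewrite sumE; case: p q => [i|j] [k|l] /=; rewrite {1}/amul /= /dsum_mul /=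
  ?amul0l ?amul0r ?zeroE ?eq_inl ?eq_inr ?tabF.2 ?tabG.2 //; by case: ifP.
Qed.

Lemma pure_tensor0l A B (y : B) : pure_tensor (0 : A) y = 0.
Proof. by apply/matrixP => i j; rewrite !mxE linear0 mul0r. Qed.

Lemma pure_tensor0r A B (x : A) : pure_tensor x (0 : B) = 0.
Proof. by apply/matrixP => i j; rewrite !mxE linear0 mulr0. Qed.

Lemma pure_tensor_sumE A B (I J : finType) (F : I -> A) (G : J -> B) :
  pure_tensor (\sum_i F i) (\sum_j G j) =
  \sum_(p : I * J) pure_tensor (F p.1) (G p.2).
Proof.
rewrite -(pair_bigA _ (fun i j => pure_tensor (F i) (G j))) /=.
have DL a (x y : A) : pure_tensor (x + y) a = pure_tensor x a + pure_tensor y a :> 'M_(_, \dim {:B}).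
  by apply/matrixP => i j; rewrite !mxE linearD /= mulrDl.
have DR a (x y : B) : pure_tensor a (x + y) = pure_tensor a x + pure_tensor a y :> 'M_(\dim {:A}, _).
  by apply/matrixP => i j; rewrite !mxE linearD /= mulrDr.
rewrite (big_morph (fun x => pure_tensor x _) (DL _) (pure_tensor0l _ _)).
by apply: eq_bigr => i _; rewrite (big_morph (pure_tensor (F i)) (DR _) (pure_tensor0r _ _)).
Qed.

Lemma has_table_tens A B (I J : finType) (F : I -> A) (G : J -> B) w w' :
  has_table F w -> has_table G w' ->
  has_table (fun p : I * J => pure_tensor (F p.1) (G p.2) : tens_alg A B)
    (tens_table w w').
Proof.
move=> tabF tabG.
have tensE (x : A) (y : B) : pure_tensor x y =
    \sum_(p : I * J) (fcoord F p.1 x * fcoord G p.2 y) *: pure_tensor (F p.1) (G p.2).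
  rewrite [in LHS](fcoord_sum tabF x) [in LHS](fcoord_sum tabG y) pure_tensor_sumE.
  by apply: eq_bigr => p _; rewrite pure_tensorZl pure_tensorZr scalerA.
apply: spanning_has_table => [M||p q].
(* The entries of [M] refer to the canonical bases; the coefficients arise by expanding those basis
   vectors in [F] and [G]. *)
- exists (fun p => \sum_i \sum_j M i j *
    (fcoord F p.1 (vbasis {:A})`_i * fcoord G p.2 (vbasis {:B})`_j)).
  under eq_bigr => p _ do rewrite scaler_suml.
  rewrite exchange_big [LHS]tens_vbasis; apply: eq_bigr => i _ /=.
  under [RHS]eq_bigr => p _ do rewrite scaler_suml.
  rewrite exchange_big; apply: eq_bigr => j _ /=.
  by rewrite tensE scaler_sumr; apply: eq_bigr => p _; rewrite scalerA.
- by rewrite card_prod -(has_table_dim tabF) -(has_table_dim tabG) [X in (_ <= X)%N]dimvf /= dim_matrix.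
rewrite tens_mulE tabF.2 tabG.2; case: p q => [i j] [k l]; rewrite xpair_eqE /=.
case: eqP => _ /=; last by rewrite pure_tensor0l.
case: eqP => _; last by rewrite pure_tensor0r.
rewrite pure_tensor_sumE; apply: eq_bigr => p _.
by rewrite pure_tensorZl pure_tensorZr scalerA.
Qed.

(** * Counting characters *)

(* These vertices correspond to the nonzero homomorphisms chi : A -> K: as
   chi(e_i) chi(e_j) = 0 for i != j, chi is supported on a single e_i, whence
   chi(e_i) = w i i, and applying chi to e_k^2 gives w k i = 0 for k != i. *)
Definition character_vertices (I : finType) (w : I -> I -> K) : {set I} :=
  [set i | (w i i != 0) && [forall k, (k != i) ==> (w k i == 0)]].

Lemma character_verticesP (I : finType) (w : I -> I -> K) i :
  reflect (w i i != 0 /\ forall k, k != i -> w k i = 0) (i \in character_vertices w).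
Proof.
rewrite inE; apply: (iffP andP) => -[wii wki]; split=> //.
  by move=> k ne; apply/eqP; apply: (implyP (forallP wki k)).
by apply/forallP => k; apply/implyP => ne; rewrite wki.
Qed.

(** A character found from the table of [F] is nonzero on exactly one vector [G j], and this [j] is
    a character vertex of [w']. As [j] determines the character on the basis [G], the map from [i]
    to [j] is injective. *)
Lemma card_character_vertices_le A (I J : finType) (F : I -> A) (G : J -> A) w w' :
  has_table F w -> has_table G w' ->
  (#|character_vertices w| <= #|character_vertices w'|)%N.
Proof.
move=> tabF tabG.
(* The character w i i *: fcoord F i, evaluated on the basis G. *)
have key i : i \in character_vertices w -> exists2 j, j \in character_vertices w' &
    forall k, fcoord F i (G k) * w i i = if k == j then w' j j else 0.
  move=> /character_verticesP[wii wki].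
  (* No other vertex has an edge into [i], so a single term of the product survives. *)
  have mulE x y : fcoord F i (amul x y) = fcoord F i x * fcoord F i y * w i i.
    rewrite (fcoord_amul tabF) (bigD1 i) //= big1 ?addr0 // => k ne.
    by rewrite wki // mulr0.
  have [j aj] : exists j, fcoord F i (G j) != 0.
    apply/existsP; apply: contraT; rewrite negb_exists => /forallP a0.
    have := fcoordE tabF i i; rewrite (fcoord_sum tabG (F i)) linear_sum big1.
      by rewrite eqxx => /eqP; rewrite eq_sym oner_eq0.
    by move=> k _; rewrite linearZ /=; move: (a0 k); rewrite negbK => /eqP ->; rewrite mulr0.
  (* Apply [mulE] to [amul (G k) (G j)], which is 0. *)
  have a0 k : k != j -> fcoord F i (G k) = 0.
    move=> ne; have := mulE (G k) (G j); rewrite tabG.2 (negPf ne) linear0.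
    by move/esym/eqP; rewrite !mulf_eq0 (negPf aj) (negPf wii) !orbF => /eqP.
  have w'E k : fcoord F i (G k) ^+ 2 * w i i = w' k j * fcoord F i (G j).
    rewrite expr2 -mulE tabG.2 eqxx linear_sum (bigD1 j) //= linearZ /= big1 ?addr0 //.
    by move=> l ne; rewrite linearZ /= a0 ?mulr0.
  have ajE : fcoord F i (G j) * w i i = w' j j.
    by apply: (mulfI aj); rewrite mulrA -expr2 w'E mulrC.
  exists j => [|k]; last by case: eqP => [->|/eqP ne]; rewrite ?ajE ?a0 ?mul0r.
  apply/character_verticesP; split=> [|k ne]; first by rewrite -ajE mulf_neq0.
  apply/eqP; have := w'E k; rewrite a0 // expr0n mul0r => /esym/eqP.
  by rewrite mulf_eq0 (negPf aj) orbF.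
(* The empty case is split off because the total choice function [m] needs a default value, here
   [j0], off the character vertices. *)
have [->|[i0 /key[j0 _ _]]] := set_0Vmem (character_vertices w); first by rewrite cards0.
have [i|m mP] := @fin_all_exists I (fun=> J) (fun i j => i \in character_vertices w ->
    j \in character_vertices w' /\
    forall k, fcoord F i (G k) * w i i = if k == j then w' j j else 0).
  case: (boolP (i \in character_vertices w)) => [/key[j inj cE]|_]; last by exists j0.
  by exists j.
have m_inj : {in character_vertices w &, injective m}.
  move=> i i' ini ini' eqm.
  have /character_verticesP[wii _] := ini.
  have [_ cE] := mP i ini; have [_ cE'] := mP i' ini'.
  (* Equal images force equal characters; at [F i] the first takes the value [w i i], while the
     second vanishes unless [i] and [i'] coincide. *)
  have : fcoord F i (F i) * w i i = fcoord F i' (F i) * w i' i'.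
    rewrite (fcoord_sum tabG (F i)) !linear_sum !mulr_suml; apply: eq_bigr => k _.
    by rewrite !linearZ /= -!mulrA cE cE' eqm.
  rewrite !(fcoordE tabF) eqxx mul1r; case: eqP => // _ /eqP.
  by rewrite mul0r (negPf wii).
rewrite -(card_in_imset m_inj) subset_leq_card //.
by apply/subsetP => _ /imsetP[i ini ->]; case: (mP i ini).
Qed.

Lemma card_character_vertices A B (I J : finType) (F : I -> A) (G : J -> B) w w' :
  has_table F w -> has_table G w' -> alg_iso A B ->
  #|character_vertices w| = #|character_vertices w'|.
Proof.
move=> tabF tabG isoAB; have [G' tabG'] := has_table_transfer isoAB tabG.
by apply/eqP; rewrite eqn_leq !(card_character_vertices_le tabF tabG',
  card_character_vertices_le tabG' tabF).
Qed.

Lemma card_character_vertices_sum (I J : finType) (w : I -> I -> K) (w' : J -> J -> K) :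
  #|character_vertices (sum_table w w')| =
  (#|character_vertices w| + #|character_vertices w'|)%N.
Proof.
have -> : character_vertices (sum_table w w') =
    [set inl i | i in character_vertices w] :|: [set inr j | j in character_vertices w'].
  apply/setP => p; rewrite in_setU; apply/idP/orP.
    case: p => [i|j] /character_verticesP[/= wii wki]; [left|right];
      apply/imset_f/character_verticesP; split=> // k ne.
      exact: (wki (inl k)).
    exact: (wki (inr k)).
  by case=> /imsetP[i /character_verticesP[wii wki] ->]; apply/character_verticesP;
    split=> // -[k|k] ne //=; apply: wki.
rewrite cardsU (_ : _ :&: _ = set0) ?cards0 ?subn0.
  by rewrite !card_imset // => ? ? [].
by apply/setP => p; rewrite !inE; apply/negP => /andP[/imsetP[i _ ->] /imsetP[]].
Qed.

(** * Algebras built from tables, and tables of given algebras *)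

Definition table_mul (I : finType) (w : I -> I -> K) (x y : {ffun I -> K^o}) :
  {ffun I -> K^o} := [ffun k => \sum_i x i * y i * w i k].

Fact table_mul_bilinear (I : finType) (w : I -> I -> K) :
  bilinear_for *:%R *:%R (table_mul w).
Proof.
split=> u k x y; apply/ffunP => l; rewrite !ffunE scaler_sumr -big_split;
  apply: eq_bigr => i _ /=; rewrite !ffunE /GRing.scale /=; ring.
Qed.
HB.instance Definition _ (I : finType) (w : I -> I -> K) :=
  bilinear_isBilinear.Build K {ffun I -> K^o} {ffun I -> K^o} {ffun I -> K^o}
    _ _ (table_mul w) (table_mul_bilinear w).

Definition table_alg (I : finType) (w : I -> I -> K) : nalg K :=
  @NAlg K {ffun I -> K^o} (table_mul w).

Lemma table_algP (I : finType) (w : I -> I -> K) :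
  has_table (fun i => [ffun k => (k == i)%:R] : table_alg w) w.
Proof.
have sumE (c : I -> K) l : (\sum_i c i *: [ffun k => (k == i)%:R : K^o]) l = c l.
  rewrite sum_ffunE (bigD1 l) //= !ffunE eqxx big1 => [|i ne].
    by rewrite addr0 /GRing.scale /= mulr1.
  by rewrite !ffunE eq_sym (negPf ne) /GRing.scale /= mulr0.
apply: spanning_has_table => [x||i j].
- by exists x; apply/ffunP => l; rewrite sumE.
- by rewrite dimvf /= /dim /= muln1.
apply/ffunP => l; rewrite /amul /= /table_mul ffunE (bigD1 i) //= big1 => [|k ne].
  rewrite !ffunE eqxx mul1r addr0; case: ifP => _; first by rewrite sumE mul1r.
  by rewrite mul0r ffunE.
by rewrite !ffunE (negPf ne) !mul0r.
Qed.

Lemma has_table_nondegenerate A (I : finType) (F : I -> A) w :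
  has_table F w -> (forall i, exists k, w i k != 0) -> Defs.nondegenerate A.
Proof.
move=> tabF w0; apply: (@nondegenerate_family K A I F) => [x||i j ne|i].
- by exists (fun i => fcoord F i x); exact: (fcoord_sum tabF).
- by rewrite (has_table_dim tabF).
- by rewrite tabF.2 (negPf ne).
have [k wik] := w0 i; apply: contraNneq wik => sq0.
by rewrite -(fcoord_comb tabF k (w i)); have := tabF.2 i i; rewrite eqxx sq0 => <-; rewrite linear0.
Qed.

Lemma natural_basis_table A n (e : n.-tuple A) :
  natural_basis e -> has_table (fun i : 'I_n => e`_i) (structure_matrix e).
Proof.
move=> nat_e; apply: spanning_has_table => [x||i j].
- by exists (fun i => coord e i x); apply: natural_basis_coord.
- by rewrite card_ord (natural_basis_dim nat_e).
case: eqP => [<-|/eqP]; last exact: nat_e.2.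
rewrite {1}(natural_basis_coord (amul e`_i e`_i) nat_e).
by apply: eq_bigr => k _; rewrite mxE.
Qed.

Definition block_table (r : nat) (n : 'I_r -> nat) (w : forall j, 'I_(n j) -> 'I_(n j) -> K)
    (p q : {j : 'I_r & 'I_(n j)}) : K :=
  if tag p == tag q then w (tag p) (tagged p) (tagged_as p q) else 0.

(** Bases of the blocks join to a basis because the sum is direct. A product of vectors from two
    different blocks lies in both ideals, hence is 0. *)
Lemma has_table_decomposition A r (U : 'I_r -> {vspace A}) (n : 'I_r -> nat)
    (e : forall j, (n j).-tuple (sub_alg (U j))) :
  (forall j, ideal (U j)) -> directv (\sum_(j < r) U j) ->
  (\sum_(j < r) U j = fullv)%VS -> (forall j, natural_basis (e j)) ->
  has_table (fun p : {j : 'I_r & 'I_(n j)} => vsval (e (tag p))`_(tagged p))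
    (block_table (fun j => structure_matrix (e j))).
Proof.
move=> idU dirU fullU nat_e; apply: spanning_has_table => [x||p q].
- have /memv_sumP[v vU ->] : x \in (\sum_(j < r) U j)%VS by rewrite fullU memvf.
  exists (fun p => coord (e (tag p)) (tagged p) (vsproj (U (tag p)) (v (tag p)))).
  rewrite -(sig_big_dep (fun=> true) (fun _ _ => true) (fun j i =>
    coord (e j) i (vsproj (U j) (v j)) *: vsval (e j)`_i)) /=.
  apply: eq_bigr => j _; rewrite -[v j in LHS](vsprojK (vU j isT)).
  rewrite [X in vsval X = _](natural_basis_coord _ (nat_e j)) linear_sum.
  by apply: eq_bigr => i _; rewrite linearZ.
- rewrite -fullU (directvP dirU) -sum1_card /=.
  rewrite -(sig_big_dep (fun=> true) (fun _ _ => true) (fun _ _ => 1%N)) /=.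
  apply: leq_sum => j _; rewrite sum1_card card_ord -(natural_basis_dim (nat_e j)).
  by rewrite dimvf.
case: (eqVneq (tag p) (tag q)) => [|ne].
  case: p q => [j i] [j' k] /= eqj; case: _ / eqj k => k.
  rewrite -sub_mulE // (natural_basis_table (nat_e j)).2 eq_Tagged /=.
  case: ifP => _; last by rewrite linear0.
  rewrite linear_sum -(sig_big_dep (fun=> true) (fun _ _ => true) (fun (j' : 'I_r) (k : 'I_(n j')) =>
    block_table (fun j => structure_matrix (e j)) (Tagged (fun j => 'I_(n j)) i)
      (Tagged (fun j => 'I_(n j)) k) *: vsval (e j')`_k)) /=.
  rewrite (bigD1 j) //= [X in _ + X]big1 => [|l ne]; last first.
    by apply: big1 => m _; rewrite /block_table /= eq_sym (negPf ne) scale0r.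
  rewrite addr0; apply: eq_bigr => l _.
  by rewrite /block_table /= eqxx tagged_asE.
rewrite (_ : p == q = false); last by apply: contraNF ne => /eqP ->.
have yU j i : vsval (e j)`_i \in U j by exact: subvsP.
apply/eqP; rewrite -memv0.
(* Directness says that [U (tag p)] meets the sum of all the other blocks trivially; that sum
   contains [U (tag q)]. *)
have /directv_sumP/(_ (tag p) isT) <- := dirU.
rewrite memv_cap (idU _ _ _ (yU _ _)).1 /=.
apply: (subvP (sumv_sup (tag q) _ (subvv _))); first by rewrite eq_sym.
exact: (idU _ _ _ (yU _ _)).2.
Qed.

End Tables.

(** * Paths, balances and potentials *)

Lemma is_gpath_cat (V : Type) (g : rel V) v p q :
  is_gpath g v (p ++ q) = is_gpath g v p && is_gpath g (last v (map snd p)) q.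
Proof. by elim: p v => //= -[fwd w] p IH v; rewrite IH andbA. Qed.

Lemma gpath_balance_cat (V : Type) (p q : seq (bool * V)) :
  gpath_balance (p ++ q) = gpath_balance p + gpath_balance q.
Proof. exact: big_cat. Qed.

Lemma gpath_reverse (V : Type) (g : rel V) v p : is_gpath g v p ->
  exists q, [/\ is_gpath g (last v (map snd p)) q,
    last (last v (map snd p)) (map snd q) = v &
    gpath_balance q = - gpath_balance p].
Proof.
elim: p v => [|[fwd w] p IH] v /=.
  by exists [::]; rewrite /gpath_balance big_nil oppr0.
move=> /andP[vw /IH[q [q_path q_last q_bal]]].
exists (q ++ [:: (~~ fwd, v)]); split.
- by rewrite is_gpath_cat q_path q_last /= andbT; case: fwd vw.
- by rewrite map_cat last_cat.
rewrite gpath_balance_cat q_bal /gpath_balance !big_cons big_nil /= addr0.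
by case: fwd {vw}; rewrite opprD ?opprK addrC.
Qed.

(** Choose a root in each component of the underlying undirected graph and let [h v] be the balance
    of a chosen path from the root to [v]. For an edge from [v] to [w], the path to [v], the edge
    and the reversed path to [w] form a cycle of balance [h v + 1 - h w]. *)
Lemma graph_potential (I : finType) (g : rel I) (d : nat) :
  (forall v p, is_gcycle g v p -> (d %| `|gpath_balance p|)%N) ->
  exists h : I -> int, forall v w, g v w -> (d %| h v + 1 - h w)%Z.
Proof.
move=> cyc_d; pose s : rel I := [rel v w | g v w || g w v].
have s_sym : connect_sym s by apply: sym_connect_sym => v w; rewrite /s /= orbC.
have gpath_to v : exists p, is_gpath g (fingraph.root s v) p /\ last (fingraph.root s v) (map snd p) = v.
  have : connect s (fingraph.root s v) v by rewrite s_sym connect_root.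
  case/connectP => p; elim: p (fingraph.root s v) => [|u p IH] x /=; first by move=> _ ->; exists [::].
  case/andP => xu /IH {}IH /IH[q [q_path q_last]].
  case/orP: xu => xu; [exists ((true, u) :: q) | exists ((false, u) :: q)];
    by rewrite /= xu q_path.
have [p pP] := fin_all_exists gpath_to.
exists (fun v => gpath_balance (p v)) => v w vw.
have eq_root : fingraph.root s v = fingraph.root s w.
  by apply/(fingraph.rootP s_sym)/connect1; rewrite /s /= vw.
have [[v_path v_last] [w_path w_last]] := (pP v, pP w).
have [q [q_path q_last q_bal]] := gpath_reverse w_path.
rewrite w_last in q_path q_last.
have := cyc_d (fingraph.root s v) (p v ++ (true, w) :: q).
rewrite /is_gcycle is_gpath_cat v_path v_last map_cat last_cat v_last /= vw /=.
rewrite q_path q_last eq_root.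
rewrite gpath_balance_cat -cat1s gpath_balance_cat q_bal /gpath_balance big_seq1 addrA.
by move=> /(_ (conj isT erefl)).
Qed.

(** * The shift permutation and the toggles *)

Section Toggle.
Variables (r : nat) (V : finZmodType) (c : 'I_r -> V).

Definition shift (p : {set 'I_r} * V) := (p.1, p.2 + \sum_(j in p.1) c j).

Definition toggle (j : 'I_r) (a : V) (p : {set 'I_r} * V) :=
  if j \in p.1 then (p.1 :\ j, p.2 - a) else (j |: p.1, p.2 + a).

Lemma toggleK j a : involutive (toggle j a).
Proof.
move=> [S v]; rewrite /toggle /=; case: (boolP (j \in S)) => jS /=.
  by rewrite setD11 /= subrK setD1K.
by rewrite setU11 /= addrK setU1K.
Qed.

(** The sum added by [shift] loses [c j] when [j] leaves the set and gains it when [j] enters;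
    raising the offset from [a] to [a + c j] makes up for exactly this. *)
Lemma toggle_shift j a p : toggle j (a + c j) (shift p) = shift (toggle j a p).
Proof.
case: p => S v; rewrite /toggle /shift /=; case: (boolP (j \in S)) => jS /=.
  rewrite (big_setD1 j jS) /=; congr pair.
  by rewrite opprD addrACA [c j + _]addrC addrK.
by rewrite big_setU1 //= addrACA [_ + c j]addrC.
Qed.

Lemma odd_toggle j a p : odd #|(toggle j a p).1| = ~~ odd #|p.1|.
Proof.
case: p => S v; rewrite /toggle /=; case: (boolP (j \in S)) => jS /=.
  by rewrite [in RHS](cardsD1 j) jS /= negbK.
by rewrite cardsU1 jS.
Qed.

Definition parity_state e := {p : {set 'I_r} * V | odd #|p.1| == e}.

Lemma toggle_parity e j a (x : parity_state e) :
  odd #|(toggle j a (val x)).1| == ~~ e.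
Proof. by rewrite odd_toggle (eqP (valP x)). Qed.

Definition toggle_state e j a (x : parity_state e) : parity_state (~~ e) :=
  Sub (toggle j a (val x)) (toggle_parity j a x).

Definition state_table (K : fieldType) e (x y : parity_state e) : K :=
  (val y == shift (val x))%:R.

Lemma state_table_neq0 (K : fieldType) e (x : parity_state e) :
  exists y, state_table K x y != 0.
Proof.
by exists (Sub (shift (val x)) (valP x)); rewrite /state_table SubK eqxx oner_eq0.
Qed.

Section TensorToggle.
Variables (K : fieldType) (I : finType) (w : I -> I -> K).
Variables (block : I -> 'I_r) (pot : I -> V).
Hypothesis potP : forall i k, w i k != 0 ->
  block k = block i /\ pot k = pot i + c (block i).

Definition tens_toggle e (p : parity_state e * I) : parity_state (~~ e) * I :=
  (toggle_state (block p.2) (pot p.2) p.1, p.2).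

(** The two parities are treated separately because [~~ ~~ e] reduces to [e] only for a concrete
    boolean [e]. *)
Lemma tens_toggleK : cancel (@tens_toggle false) (@tens_toggle true).
Proof.
by move=> [x i]; congr pair; apply: val_inj; rewrite /= toggleK.
Qed.

Lemma tens_toggleVK : cancel (@tens_toggle true) (@tens_toggle false).
Proof.
by move=> [x i]; congr pair; apply: val_inj; rewrite /= toggleK.
Qed.

(** Both sides vanish when [w i k] is 0. Otherwise [i] and [k] share a block [j], and the offset at
    [k] exceeds that at [i] by [c j]; by [toggle_shift] and injectivity of the toggle, the shift
    condition holds after toggling exactly when it held before. *)
Lemma tens_toggle_table e (p q : parity_state e * I) :
  tens_table (@state_table K (~~ e)) w (tens_toggle p) (tens_toggle q) =
  tens_table (@state_table K e) w p q.
Proof.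
case: p q => [x i] [y k]; rewrite /tens_table /=.
have [->|wik] := eqVneq (w i k) 0; first by rewrite !mulr0.
have [blockE potE] := potP wik; rewrite /state_table /= blockE potE -toggle_shift.
by rewrite (inj_eq (inv_inj (toggleK _ _))).
Qed.

End TensorToggle.

Hypothesis c_free : forall S : {set 'I_r}, \sum_(j in S) c j = 0 -> S = set0.

Lemma shift_fixed p : shift p = p -> p.1 = set0.
Proof. by case: p => S v /(congr1 snd) /= /eqP; rewrite -subr_eq0 addrC addKr => /eqP/c_free. Qed.

Lemma odd_state_characters (K : fieldType) :
  #|character_vertices (@state_table K true)| = 0%N.
Proof.
apply/eqP; rewrite cards_eq0; apply/eqP/setP => x; rewrite in_set0.
apply/negP => /character_verticesP[]; rewrite /state_table.
have [/esym/shift_fixed x0 _ _|_] := eqVneq (val x); last by rewrite eqxx.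
by have := valP x; rewrite /= x0 cards0.
Qed.

Lemma even_state_characters (K : fieldType) :
  (0 < #|character_vertices (@state_table K false)|)%N.
Proof.
have par0 : odd #|(set0 : {set 'I_r}, 0 : V).1| == false by rewrite cards0.
apply/card_gt0P; exists (Sub (set0, 0) par0); apply/character_verticesP.
rewrite /state_table !SubK; split=> [|x].
  by rewrite /shift /= big_set0 addr0 eqxx oner_eq0.
(* If [x] has an edge into [(set0, 0)], its set is empty too, so [shift] fixes [x] and [x] equals
   its image. *)
apply: contraNeq; have [eqx _|_] := eqVneq (set0, 0); last by rewrite eqxx.
rewrite -val_eqE SubK; have := congr1 fst eqx; rewrite /= => x0.
by rewrite eqx /shift -x0 big_set0 addr0 {1}x0 -surjective_pairing.
Qed.

End Toggle.

(** * Passage to the Grothendieck ring *)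

(** As the class of [X] is the pair [(X, nd0)], the product also involves tensor products with the
    zero algebra. Their bases are indexed by empty types such as [J * void], so both sides of the
    equation have, up to reindexing, the table of the tensor product of [A] and [X]. *)
Lemma groth_tensor_sides (K : fieldType) (A B X : ndalg K) (I J L : finType)
    (F : I -> A) (G : J -> B) (H : L -> X) (wA : I -> I -> K) (wB : J -> J -> K)
    (wX : L -> L -> K) (f : I * L -> J * L) :
  has_table F wA -> has_table G wB -> has_table H wX -> bijective f ->
  (forall p q, tens_table wB wX (f p) (f q) = tens_table wA wX p q) ->
  alg_iso (ndtens A X) (ndtens B X) /\
  groth_eq (groth_mul (A, B) (groth_class X)) (groth0 K).
Proof.
move=> tabA tabB tabX [g fK gK] fE.
have tab0 := has_table_zero K.
split.
  apply: (has_table_iso (has_table_tens tabA tabX)).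
  by apply: (has_table_reindex _ _ (has_table_tens tabB tabX)); [exists g | exact: fE].
(* The two sides are already isomorphic, so the stabilizing summand can be zero. *)
exists (nd0 K).
have tabL := has_table_sum (has_table_sum (has_table_sum
  (has_table_tens tabA tabX) (has_table_tens tabB tab0)) tab0) tab0.
have tabR := has_table_sum (has_table_sum tab0 (has_table_sum
  (has_table_tens tabA tab0) (has_table_tens tabB tabX))) tab0.
apply: (@has_table_iso K _ _ (I * L)%type _ _ (tens_table wA wX)).
  apply: (has_table_reindex (f := inl \o inl \o inl) _ _ tabL) => //.
  exists (fun p : (I * L + J * void) + void + void => match p with
    | inl (inl (inl q)) => q
    | inl (inl (inr (_, v))) | inl (inr v) | inr v => match v with end
    end) => //; by case=> [[[p|[? []]]|[]]|[]].
apply: (has_table_reindex (f := inl \o inr \o inr \o f) _ _ tabR) => [|p q]; last exact: fE.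
exists (fun p : (void + (I * void + J * L)) + void => match p with
  | inl (inr (inr q)) => g q
  | inl (inr (inl (_, v))) | inl (inl v) | inr v => match v with end
  end) => [p|]; first exact: fK.
by case=> [[[]|[[? []]|p]]|[]] /=; rewrite gK.
Qed.

(** The count of character vertices is additive with natural number values, so the contribution of
    the unknown stabilizing summand [Z] cancels. *)
Lemma groth_neq0 (K : fieldType) (A B : ndalg K) (I J : finType)
    (F : I -> A) (G : J -> B) (wA : I -> I -> K) (wB : J -> J -> K) :
  has_table F wA -> has_table G wB ->
  #|character_vertices wA| <> #|character_vertices wB| ->
  ~ groth_eq (A, B) (groth0 K).
Proof.
move=> tabA tabB neAB [Z isoZ]; apply: neAB.
have tab0 := has_table_zero K.
have void_characters (w : void -> void -> K) : #|character_vertices w| = 0%N.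
  by apply/eqP; rewrite cards_eq0; apply/eqP/setP => -[].
have [n [e [/natural_basis_table tabZ _]]] := ndalg_nondegenerate Z.
have := card_character_vertices (has_table_sum (has_table_sum tabA tab0) tabZ)
  (has_table_sum (has_table_sum tab0 tabB) tabZ) isoZ.
rewrite !card_character_vertices_sum => /addIn.
by rewrite !void_characters addn0.
Qed.

(** * The group, the potential and the final assembly *)

Lemma independent_torsion r (b : 'I_r -> nat) : (forall j, (1 < b j)%N) ->
  exists (V : finZmodType) (c : 'I_r -> V), (forall j, c j *+ b j = 0) /\
    (forall S : {set 'I_r}, \sum_(j in S) c j = 0 -> S = set0).
Proof.
move=> b_gt1; pose M := (\prod_(j < r) b j)%N.
have M_gt0 : (0 < M)%N by rewrite prodn_gt0 // => j; exact: ltnW.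
have bM j : (b j %| M)%N by rewrite /M (bigD1 j) //= dvdn_mulr.
(* ['Z_M] is the ring of integers modulo [M] only for [M > 1]. Any index [j] ensures this; for
   [r = 0] the rows have length 0 and the modulus does not matter. *)
have M_gt1 (j : 'I_r) : (1 < M)%N by apply: leq_trans (b_gt1 j) (dvdn_leq M_gt0 (bM j)).
(* Here [c j] is [M %/ b j] times the [j]-th unit vector, an element of order [b j]. A subset sum
   over a set containing [k] has [k]-th coordinate [M %/ b k], which is nonzero modulo [M] because
   [b k > 1]. *)
exists 'rV['Z_M]_r, (fun j => \row_k ((k == j)%:R * (M %/ b j)%N%:R)).
split=> [j|S /rowP sum0].
  apply/rowP => k; rewrite mulmxnE !mxE -mulrnAr -mulrnA divnK //.
  by rewrite pchar_Zp ?mulr0 // (M_gt1 j).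
apply/setP => k; rewrite in_set0; apply/negP => kS.
have := sum0 k; rewrite summxE (bigD1 k) //= big1 => [|j /andP[_ ne]]; last first.
  by rewrite mxE eq_sym (negPf ne) mul0r.
rewrite addr0 !mxE eqxx mul1r => /(congr1 val) /=.
rewrite val_Zp_nat ?(M_gt1 k) // modn_small ?ltn_Pdiv // => /eqP.
by rewrite -leqn0 leqNgt divn_gt0 ?(ltnW (b_gt1 k)) // dvdn_leq.
Qed.

(** On each block the balance yields an integer potential that rises by 1 modulo [b j] along edges.
    Taking it as a multiple of [c j] makes the rise exactly [c j], since [b j] kills [c j]. *)
Lemma decomposition_potential (K : fieldType) (X : nalg K) (r : nat)
    (U : 'I_r -> {vspace X}) (b : 'I_r -> nat) (V : finZmodType) (c : 'I_r -> V) :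
  optimal_decomposition U -> (forall j, has_balance (sub_alg (U j)) (b j)) ->
  (forall j, c j *+ b j = 0) ->
  exists (I : finType) (F : I -> X) (w : I -> I -> K) (block : I -> 'I_r) (pot : I -> V),
    has_table F w /\
    forall i k, w i k != 0 -> block k = block i /\ pot k = pot i + c (block i).
Proof.
move=> [idU dirU fullU] balU cb0.
have [n /fin_all_exists[e eP]] := fin_all_exists balU.
have /fin_all_exists[h hP] j : exists h : 'I_(n j) -> int, forall v w,
    evolution_graph (e j) v w -> (b j %| h v + 1 - h w)%Z.
  apply: graph_potential => v p cyc_p; apply: (eP j).2.1.
  by exists v, p.
have tabX := has_table_decomposition (fun j => (idU j).1.1) dirU fullU
  (fun j => (eP j).1).
pose vertex := {j : 'I_r & 'I_(n j)}.
exists vertex, (fun p : vertex => vsval (e (tag p))`_(tagged p)).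
exists (block_table (fun j => structure_matrix (e j))), (fun p : vertex => tag p).
exists (fun p : vertex => c (tag p) *~ h (tag p) (tagged p)); split=> // p q.
rewrite /block_table; have [eq_pq|_] := eqVneq (tag p) (tag q); last by rewrite eqxx.
case: p q eq_pq => [j i] [j' k] /= eq_j; case: _ / eq_j k => k.
rewrite tagged_asE => /hP /dvdzP[z zE]; split=> //.
apply/esym/eqP; rewrite -subr_eq0 -{2}[c j]mulr1z -mulrzDr -mulrzBr zE.
by rewrite mulrC mulrzA -pmulrn cb0 mul0rz.
Qed.

Lemma potential_zero_divisor (K : fieldType) (X : ndalg K) (r : nat) (I : finType)
    (F : I -> X) (w : I -> I -> K) (V : finZmodType) (c : 'I_r -> V)
    (block : I -> 'I_r) (pot : I -> V) :
  has_table F w ->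
  (forall i k, w i k != 0 -> block k = block i /\ pot k = pot i + c (block i)) ->
  (forall S : {set 'I_r}, \sum_(j in S) c j = 0 -> S = set0) ->
  exists A B : ndalg K,
    [/\ alg_iso (ndtens A X) (ndtens B X),
        ~ alg_iso A B
      & zero_divisor_witness (groth_class X) (A, B)].
Proof.
move=> tabX potP c_free.
pose A := NdAlg (has_table_nondegenerate
  (table_algP (@state_table r V c K false)) (@state_table_neq0 r V c K false)).
pose B := NdAlg (has_table_nondegenerate
  (table_algP (@state_table r V c K true)) (@state_table_neq0 r V c K true)).
have tabA : has_table (A := A) _ _ := table_algP (@state_table r V c K false).
have tabB : has_table (A := B) _ _ := table_algP (@state_table r V c K true).
have [isoX grothX] := groth_tensor_sides tabA tabB tabX
  (Bijective (tens_toggleK block pot) (tens_toggleVK block pot))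
  (tens_toggle_table potP (e := false)).
have neAB : #|character_vertices (@state_table _ _ c K false)| <>
    #|character_vertices (@state_table _ _ c K true)|.
  rewrite (odd_state_characters c_free) => eq0.
  by have := even_state_characters c K; rewrite eq0.
exists A, B; split=> //.
  by move=> /(card_character_vertices tabA tabB).
split=> //; exact: groth_neq0 tabA tabB neAB.
Qed.

Local Close Scope ring_scope.

Theorem theorem1 (K : fieldType) (X : ndalg K) (r : nat)
    (U : 'I_r -> {vspace X}) (b : 'I_r -> nat)
    (decU : optimal_decomposition U)
    (balU : forall j, has_balance (sub_alg (U j)) (b j))
    (b_gt1 : forall j, 1 < b j) :
  exists A B : ndalg K,
    [/\ alg_iso (ndtens A X) (ndtens B X),
        ~ alg_iso A B
      & zero_divisor_witness (groth_class X) (A, B)].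
Proof.
have [V [c [cb0 c_free]]] := independent_torsion b_gt1.
have [I [F [w [block [pot [tabX potP]]]]]] := decomposition_potential decU balU cb0.
exact: potential_zero_divisor tabX potP c_free.
Qed.
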